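(* Let $(\mathbb{V},\mathbb{W},\lambda)$ be a finite-dimensional FTvN system with $\mathcal{K}:=\lambda(\mathbb{V})$, and let $\mathcal{C}\subseteq\mathbb{W}$ be feasible, i.e. $\mathcal{C}\cap\mathcal{K}\neq\emptyset$. (i) The following three statements are equivalent: (a) $(\mathsf{conv}\,\mathcal{C})\cap\mathcal{K}\subseteq\mathsf{conv}(\mathcal{C}\cap\mathcal{K})+\mathcal{K}^\circ$. (b) For any convex $\mathcal{D}$ that satisfies $\mathsf{conv}(\mathcal{C}\cap\mathcal{K})\subseteq\mathcal{D}\subseteq(\mathsf{conv}\,\mathcal{C})\cap\mathcal{K}$, we have $\mathsf{conv}\,\lambda^{-1}(\mathcal{C})=\lambda^{-1}(\mathcal{D}+\mathcal{K}^\circ)$. (c) $\mathsf{conv}\,\lambda^{-1}(\mathcal{C})=\lambda^{-1}\big(((\mathsf{conv}\,\mathcal{C})\cap\mathcal{K})+\mathcal{K}^\circ\big)$. (ii) The following three statements are equivalent: (a) $(\mathsf{clconv}\,\mathcal{C})\cap\mathcal{K}\subseteq\mathsf{cl}\big(\mathsf{clconv}(\mathcal{C}\cap\mathcal{K})+\mathcal{K}^\circ\big)$. (b) For any convex $\mathcal{D}$ that satisfies $\mathsf{conv}(\mathcal{C}\cap\mathcal{K})\subseteq\mathcal{D}\subseteq(\mathsf{clconv}\,\mathcal{C})\cap\mathcal{K}$, we have $\mathsf{clconv}\,\lambda^{-1}(\mathcal{C})=\mathsf{cl}\,\lambda^{-1}(\mathcal{D}+\mathcal{K}^\circ)$. (c)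 $\mathsf{clconv}\,\lambda^{-1}(\mathcal{C})=\mathsf{cl}\,\lambda^{-1}\big(((\mathsf{clconv}\,\mathcal{C})\cap\mathcal{K})+\mathcal{K}^\circ\big)$.
   Context: Let $\mathbb{V},\mathbb{W}$ be finite-dimensional real inner-product spaces and $\lambda:\mathbb{V}\to\mathbb{W}$ a (generally nonlinear) map. $(\mathbb{V},\mathbb{W},\lambda)$ is called an FTvN system if: (P1) $\langle x,y\rangle\le\langle\lambda(x),\lambda(y)\rangle$ for all $x,y\in\mathbb{V}$; and (P2) for all $c\in\mathbb{V}$ and $u\in\lambda(\mathbb{V})$ there exists $x\in\mathbb{V}$ such that $\lambda(x)=u$ and $\langle c,x\rangle=\langle\lambda(c),\lambda(x)\rangle$. In this case the range $\mathcal{K}:=\lambda(\mathbb{V})\subseteq\mathbb{W}$ is known to be a nonempty closed convex cone. Its polar cone is $\mathcal{K}^\circ:=\{y\in\mathbb{W}:\langle y,x\rangle\le 0\ \forall x\in\mathcal{K}\}$. For a set $\mathcal{A}\subseteq\mathbb{W}$, $\lambda^{-1}(\mathcal{A}):=\{x\in\mathbb{V}:\lambda(x)\in\mathcal{A}\}$ is the preimage. $\mathsf{conv}$, $\mathsf{cl}$ and $\mathsf{clconv}$ denote convex hull, closure and closed convex hull; sums of sets are Minkowski sums. *)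

(* Defs.v *)
From HB Require Import structures.
From mathcomp Require Import all_boot all_order all_algebra.
From mathcomp Require Import boolp classical_sets reals.
From mathcomp Require Import topology normedtype convex.

Set Implicit Arguments.
Unset Strict Implicit.
Unset Printing Implicit Defensive.

Import Order.TTheory GRing.Theory Num.Theory.
Import numFieldNormedType.Exports.

Local Open Scope classical_set_scope.
Local Open Scope ring_scope.

(* A finite-dimensional real inner-product space: [Vector] gives the finite
   dimension, and [inner_norm] forces the norm (hence the topology) of the
   normed module to be the one induced by the inner product. *)
HB.mixin Record NormedVector_isInner (R : realType) V
    of Vector R V & NormedModule R V := {
  inner : {dot V for (@idfun R)} ;
  inner_norm : forall x : V, inner x x = `|x| ^+ 2 }.

#[short(type="innerSpaceType")]
HB.structure Definition InnerSpace (R : realType) :=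
  {V of NormedVector_isInner R V & Vector R V & NormedModule R V}.

Notation "'<< x , y >>" := (inner x y)
  (at level 0, x at level 99, y at level 99,
   format "''<<' x ,  y '>>'") : ring_scope.

Section ConvexGeometry.
Variables (R : realType) (V : innerSpaceType R).
Implicit Types A B K : set V.

Definition convex_hull A : set V := smallest (@convex_set R V) A.

Definition closed_convex_hull A : set V := closure (convex_hull A).

Definition minkowski_sum A B : set V := [set a + b | a in A & b in B].

Definition polar K : set V := [set y | forall x, K x -> '<<y, x>> <= 0].

End ConvexGeometry.

Definition is_FTvN (R : realType) (V W : innerSpaceType R) (lam : V -> W) :=
  (forall x y : V, '<<x, y>> <= '<<lam x, lam y>>) /\
  (forall (c : V) (u : W), range lam u ->
     exists x : V, lam x = u /\ '<<c, x>> = '<<lam c, lam x>>).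

(* Main.v *)
(* The key point is conv lam^-1(C) = lam^-1(conv(C & K) + K°), with no condition
   on C. The preimage of D + K° is convex for convex D because lam is sublinear
   modulo K°. Conversely, if lam x is below some u in K on K, then x lies in
   conv lam^-1(u): a separating functional c would satisfy
   <c, x> <= <lam c, lam x> <= <lam c, u> = max of <c, .> on lam^-1(u). The fibre
   is compact, so its hull is closed by Caratheodory's theorem; finally (P2)
   lifts convex combinations in K to convex combinations in V. The same
   separation argument, with an epsilon, shows that the preimage of
   cl(conv(C & K) + K°) lies in clconv lam^-1(C); continuity of lam gives the
   way back in part (ii). *)
Require Import Defs.
From HB Require Import structures.
From mathcomp Require Import all_boot all_order all_algebra.
From mathcomp Require Import boolp classical_sets reals.
From mathcomp Require Import topology normedtype convex.
From mathcomp Require Import interval_inference derive.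
From mathcomp Require Import ring lra.

Set Implicit Arguments.
Unset Strict Implicit.
Unset Printing Implicit Defensive.

Import Order.TTheory GRing.Theory Num.Theory.
Import numFieldNormedType.Exports.

Local Open Scope classical_set_scope.
Local Open Scope ring_scope.

(** * Inner products and the Cauchy-Schwarz inequality *)

Section InnerProduct.
Variables (R : realType) (V : innerSpaceType R).
Implicit Types x y z : V.

Lemma innerC x y : '<<x, y>> = '<<y, x>>.
Proof. by have := hermC inner x y; rewrite expr0 mul1r. Qed.

Lemma innerDl x y z : '<<x + y, z>> = '<<x, z>> + '<<y, z>>.
Proof. exact: linearDl. Qed.

Lemma innerZl a x y : '<<a *: x, y>> = a * '<<x, y>>.
Proof. exact: linearZl_LR. Qed.

Lemma innerNl x y : '<<- x, y>> = - '<<x, y>>.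
Proof. exact: linearNl. Qed.

Lemma innerDr x y z : '<<z, x + y>> = '<<z, x>> + '<<z, y>>.
Proof. by rewrite innerC innerDl !(innerC z). Qed.

Lemma innerZr a x y : '<<y, a *: x>> = a * '<<y, x>>.
Proof. by rewrite innerC innerZl innerC. Qed.

Lemma innerNr x y : '<<y, - x>> = - '<<y, x>>.
Proof. by rewrite innerC innerNl innerC. Qed.

Definition innerE := (innerDl, innerDr, innerNl, innerNr, innerZl, innerZr).

Lemma inner_ge0 x : 0 <= '<<x, x>>.
Proof. by rewrite inner_norm exprn_ge0. Qed.

Lemma inner_le0 x : '<<x, x>> <= 0 -> x = 0.
Proof.
move=> x0; apply/eqP; rewrite -normr_eq0 -sqrf_eq0 -inner_norm.
by rewrite eq_le x0 inner_ge0.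
Qed.

(** The two hypotheses add up to the squared norm of [x - y] being at most 0. Vectors are identified
    below through this test. *)
Lemma inner_eq x y :
  '<<x, x>> <= '<<x, y>> -> '<<y, y>> <= '<<x, y>> -> x = y.
Proof.
move=> xxy yxy; apply/eqP; rewrite -subr_eq0; apply/eqP/inner_le0.
by rewrite !innerE [inner y x]innerC; lra.
Qed.

Lemma inner_le_norm x y : '<<x, y>> <= `|x| * `|y|.
Proof.
have [->|x0] := eqVneq x 0; first by rewrite -(scale0r 0) innerZl mul0r mulr_ge0.
have [->|y0] := eqVneq y 0; first by rewrite -(scale0r 0) innerZr mul0r mulr_ge0.
have {x0 y0} p0 : 0 < `|x| * `|y| by rewrite mulr_gt0 ?normr_gt0.
(* With p = |x| |y|, this square expands to 2 p (p - <x, y>), and p > 0. *)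
have := inner_ge0 (`|y| *: x - `|x| *: y).
rewrite !innerE [inner y x]innerC !inner_norm -(ler_pM2l p0); nra.
Qed.

Lemma norm_le_inner (U : innerSpaceType R) x (y : U) :
  '<<x, x>> <= '<<y, y>> -> `|x| <= `|y|.
Proof. by rewrite !inner_norm ler_sqr ?nnegrE. Qed.

End InnerProduct.

(** * Convexity, closure and polar cones *)

Section ConvexSets.
Variables (R : realType) (V : innerSpaceType R).
Implicit Types (A B : set V) (x y : V).

Lemma convex_setP A : convex_set A <->
  forall x y t, A x -> A y -> 0 <= t -> t <= 1 -> A (t *: x + (1 - t) *: y).
Proof.
split=> cA x y.
  move=> t Ax Ay t0 t1.
  have := cA x y (Itv01 t0 t1); rewrite !inE; exact.
by move=> l; rewrite !inE => Ax Ay; exact: cA.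
Qed.

Lemma convex_convex_hull A : convex_set (convex_hull A).
Proof.
apply/convex_setP => x y t hx hy t0 t1 B [cB AB].
by move/convex_setP : (cB); apply => //; [exact: hx|exact: hy].
Qed.

Lemma convex_setI A B : convex_set A -> convex_set B -> convex_set (A `&` B).
Proof.
move=> /convex_setP cA /convex_setP cB.
by apply/convex_setP => x y t [Ax Bx] [Ay By] t0 t1; split; [exact: cA|exact: cB].
Qed.

Lemma convex_minkowski_sum A B :
  convex_set A -> convex_set B -> convex_set (minkowski_sum A B).
Proof.
move=> /convex_setP cA /convex_setP cB.
apply/convex_setP => _ _ t [a Aa [b Bb <-]] [c Ac [d Bd <-]] t0 t1.
exists (t *: a + (1 - t) *: c); first exact: cA.
exists (t *: b + (1 - t) *: d); first exact: cB.
by rewrite !scalerDr addrACA.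
Qed.

Lemma minkowski_sumS A A' B :
  A `<=` A' -> minkowski_sum A B `<=` minkowski_sum A' B.
Proof. by move=> AA' _ [a Aa [b Bb <-]]; exists a; [exact: AA'|exists b]. Qed.

Lemma closure_normP A x :
  closure A x <-> forall e, 0 < e -> exists2 y, A y & `|x - y| < e.
Proof.
split=> [clA e e0|clA B].
  have [y [Ay]] := clA _ (nbhsx_ballx x e e0).
  by rewrite -ball_normE => xy; exists y.
rewrite -nbhs_ballE => -[e /= e0 eB]; have [y Ay xy] := clA e e0.
by exists y; split=> //; apply: eB; rewrite -ball_normE.
Qed.

Lemma convex_closure A : convex_set A -> convex_set (closure A).
Proof.
move=> /convex_setP cA; apply/convex_setP => x y t Ax Ay t0 t1.
apply/closure_normP => e e0.
have [a Aa xa] := (closure_normP _ _).1 Ax _ e0.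
have [b Ab yb] := (closure_normP _ _).1 Ay _ e0.
exists (t *: a + (1 - t) *: b); first exact: cA.
rewrite opprD addrACA -!scalerBr (le_lt_trans (ler_normD _ _))//.
rewrite !normrZ (ger0_norm t0) ger0_norm ?subr_ge0//.
have [->|t_neq0] := eqVneq t 0; first by rewrite mul0r add0r subr0 mul1r.
have {t_neq0} t_gt0 : 0 < t by rewrite lt_neqAle eq_sym t_neq0.
have : t * `|x - a| < t * e by rewrite ltr_pM2l.
have : (1 - t) * `|y - b| <= (1 - t) * e by rewrite ler_wpM2l ?subr_ge0// ltW.
lra.
Qed.

(** A polar cone is closed under addition, so translating an approximant by [k] keeps it in the sum
    and preserves its distance. *)
Lemma closure_minkowski_sum_polar A K u k :
  closure (minkowski_sum A (polar K)) u -> polar K k ->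
  closure (minkowski_sum A (polar K)) (u + k).
Proof.
move=> /closure_normP clu Kk; apply/closure_normP => e /clu[_ [a Aa [b Kb <-]]].
move=> ue; exists (a + (b + k)); last first.
  by rewrite addrA opprD addrACA subrr addr0.
exists a => //; exists (b + k) => // w Kw.
by rewrite innerDl -[leRHS]addr0 lerD ?Kb ?Kk.
Qed.

Lemma polar0 K : polar K (0 : V).
Proof. by move=> w _; rewrite -(scale0r 0) innerZl mul0r. Qed.

Lemma convex_polar K : convex_set (polar K : set V).
Proof.
apply/convex_setP => x y t Kx Ky t0 t1 w Kw; rewrite !innerE.
by have := Kx _ Kw; have := Ky _ Kw; nra.
Qed.

Lemma sub_minkowski_sum_polar A K : A `<=` minkowski_sum A (polar K).
Proof.
by move=> a Aa; exists a => //; exists 0; [exact: polar0|rewrite addr0].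
Qed.

End ConvexSets.

(** * Compactness in finite dimension *)

Section FiniteDimension.
Variables (R : realType) (V : innerSpaceType R).
Import VectorInternalTheory.

Lemma r2v_continuous : continuous (r2v : 'rV[R]_(dim V) -> V).
Proof.
have -> : (r2v : 'rV[R]_(dim V) -> V) =
    (fun v => \sum_i v ord0 i *: r2v (delta_mx ord0 i)).
  apply/funext => v; rewrite {1}[v]row_sum_delta linear_sum.
  by apply: eq_bigr => i _; rewrite linearZ.
apply: (continuous_big add_continuous) => i _ v.
by apply: continuousZr_tmp; exact: coord_continuous.
Qed.

(** Compactness is carried over from row vectors through [r2v]. The preimage is bounded there
    because the norm of [r2v v] has a positive minimum on the unit sphere. *)
Lemma bounded_closed_compact_inner (A : set V) (M : R) :
  (forall x, A x -> `|x| <= M) -> closed A -> compact A.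
Proof.
move=> AM cA; pose f : 'rV[R]_(dim V) -> V := r2v.
have fA : f @` (f @^-1` A) = A.
  apply/seteqP; split=> [_ [v ? <-]//|x Ax].
  by exists (v2r x); rewrite /f/= v2rK.
have cf := r2v_continuous; rewrite -fA; apply: continuous_compact.
  exact: continuous_subspaceT.
apply: bounded_closed_compact; last exact: ((continuous_closedP _).1 cf).
pose S := [set v : 'rV[R]_(dim V) | `|v| = 1].
have S_normalize v : v != 0 -> S (`|v|^-1 *: v).
  by move=> v0; rewrite /S/= normrZ normfV normr_id mulVf ?normr_eq0.
(* In dimension zero the sphere is empty and the only vector is 0. *)
have [S0|/set0P S_neq0] := eqVneq S set0.
  exists 0; split=> // M' M'0 v _ /=; have [->|/S_normalize] := eqVneq v 0.
    by rewrite normr0 ltW.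
  by rewrite S0.
have cS : compact S.
  apply: bounded_closed_compact.
    by exists 1; split=> // M' M'1 v /= ->; rewrite ltW.
  exact: ((continuous_closedP _).1 (@norm_continuous R 'rV[R]_(dim V)) _
    (closed_eq (y := 1))).
have [] := @compact_EVT_min _ R (fun v => `|f v|) S S_neq0 cS.
  apply: continuous_subspaceT => v; apply: continuous_comp; first exact: cf.
  exact: norm_continuous.
move=> s /set_mem Ss min_s.
have m0 : 0 < `|f s|.
  rewrite normr_gt0; apply/eqP => fs0; move: Ss; rewrite /S/=.
  have -> : s = 0 by rewrite -(r2vK s) [r2v s]fs0 linear0.
  by rewrite normr0 => /esym/eqP; rewrite oner_eq0.
exists (M / `|f s|); split; first exact: num_real.
move=> M' /ltW M'M v Av; apply: le_trans M'M; rewrite ler_pdivlMr//.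
have [->|v0] := eqVneq v 0.
  by rewrite normr0 mul0r (le_trans _ (AM _ Av)).
have /mem_set/min_s := S_normalize _ v0.
rewrite /f linearZ normrZ normfV normr_id ler_pdivlMl ?normr_gt0//.
by move=> /le_trans; apply; exact: AM.
Qed.

End FiniteDimension.

(** * Projection onto closed convex sets and separation *)

Section Separation.
Variables (R : realType) (V : innerSpaceType R).
Implicit Types (S Y : set V) (x c : V).

Lemma closest_point Y x : Y !=set0 -> closed Y ->
  exists2 p, Y p & forall y, Y y -> `|x - p| <= `|x - y|.
Proof.
move=> [s Ys] cY; pose B := Y `&` [set y | `|x - y| <= `|x - s|].
have cont : continuous (fun y : V => `|x - y|).
  by move=> y; apply: cvg_norm; apply: cvgB; [exact: cvg_cst|exact: cvg_id].
have cB : compact B.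
  apply: (@bounded_closed_compact_inner _ _ _ (`|x - s| + `|x|)).
    move=> y [_ /= ys]; rewrite -[y](subKr x) (le_trans (ler_normB _ _))//.
    by rewrite addrC lerD2r.
  apply: closedI => //.
  exact: ((continuous_closedP _).1 cont _ (closed_le (y := _))).
have [||p /set_mem[Yp _] min_p] := compact_EVT_min _ cB (f := fun y => `|x - y|).
- by exists s; split=> /=.
- exact: continuous_subspaceT.
exists p => // y Yy; have [ys|/ltW sy] := lerP `|x - y| `|x - s|.
  by apply: min_p; rewrite inE.
by apply: le_trans sy; apply: min_p; rewrite inE; split=> /=.
Qed.

Lemma closest_point_inner Y x p : convex_set Y -> Y p ->
  (forall y, Y y -> `|x - p| <= `|x - y|) ->
  forall y, Y y -> '<<x - p, y>> <= '<<x - p, p>>.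
Proof.
move=> /convex_setP cY Yp minp y Yy; rewrite leNgt; apply/negP => gt.
have g_gt0 : 0 < '<<x - p, y - p>> by rewrite innerDr innerNr subr_gt0.
set g := '<<x - p, y - p>> in g_gt0.
pose n := '<<y - p, y - p>>; have n0 : 0 <= n by exact: inner_ge0.
(* Moving from [p] towards [y] by [t] changes the squared distance by -2tg + t^2 n. Since t(g + n) =
   g, this is -tg - t^2 g < 0, against minimality. *)
pose t := g / (g + n); have gn : 0 < g + n by rewrite ltr_wpDr.
have t0 : 0 < t by rewrite divr_gt0.
have tE : t * (g + n) = g by rewrite /t divfK ?gt_eqF.
have t1 : t <= 1 by rewrite ler_pdivrMr// mul1r lerDl.
have := minp _ (cY _ _ _ Yy Yp (ltW t0) t1).
have -> : x - (t *: y + (1 - t) *: p) = (x - p) - t *: (y - p).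
  by rewrite scalerBl scale1r scalerBr -addrA -opprD addrCA.
rewrite -ler_sqr ?nnegrE// -!inner_norm.
have -> : forall a b : V, '<<a - t *: b, a - t *: b>> =
    '<<a, a>> - 2 * t * '<<a, b>> + t ^+ 2 * '<<b, b>>.
  by move=> a b; rewrite !innerE [inner b a]innerC; ring.
rewrite -/g -/n; nra.
Qed.

(** If [x] were outside the closed hull, with projection [p], the functional [x - p] would exceed
    its values on [S] by at least the squared distance; a slack [e] of half that amount is
    contradictory. *)
Lemma support_closed_convex_hull S x : S !=set0 ->
  (forall c e, 0 < e -> exists2 y, S y & '<<c, x>> <= '<<c, y>> + e) ->
  closed_convex_hull S x.
Proof.
move=> S0 supp; set Y := closed_convex_hull S.
have SY : S `<=` Y by move=> s Ss; apply: subset_closure; exact: sub_gen_smallest.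
have cY : convex_set Y by apply: convex_closure; exact: convex_convex_hull.
have [|p Yp minp] := @closest_point Y x _ (@closed_closure _ _).
  by case: S0 => s /SY; exists s.
suff /inner_le0/eqP : '<<x - p, x - p>> <= 0 by rewrite subr_eq0 => /eqP ->.
rewrite leNgt; apply/negP => q0.
have [|y /SY Yy] := supp (x - p) ('<<x - p, x - p>> / 2); first by rewrite divr_gt0.
have := closest_point_inner cY Yp minp Yy.
have : '<<x - p, x - p>> = '<<x - p, x>> - '<<x - p, p>> by rewrite innerDr innerNr.
lra.
Qed.

End Separation.

(** * Caratheodory's theorem for conic combinations *)

Section Caratheodory.
Variables (R : realFieldType) (U : vectType R) (m : nat) (v : 'I_m -> U).

(** More vectors than the dimension satisfy a nontrivial relation; a change of sign makes one
    coefficient positive. *)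
Lemma linear_dependence (A : {pred 'I_m}) : (\dim {:U} < #|A|)%N ->
  exists mu : 'I_m -> R, [/\ exists2 i, i \in A & 0 < mu i,
    forall i, i \notin A -> mu i = 0 & \sum_i mu i *: v i = 0].
Proof.
move=> dA; pose X := [tuple v (enum_val i) | i < #|A|].
have nfX : ~ (free X).
  move=> /eqP fX; move: dA; rewrite -[X in (_ < X)%N](size_tuple X) -fX.
  by rewrite ltnNge dimvS ?subvf.
have [k [kX [i0 ki0]]] : exists k : 'I_#|A| -> R,
    \sum_i k i *: X`_i = 0 /\ exists i, 0 < k i.
  have [k [kX [i /eqP ki]]] : exists k : 'I_#|A| -> R,
      \sum_i k i *: X`_i = 0 /\ exists i, k i <> 0.
    apply: contrapT => nk; apply: nfX; apply/freeP => k kX i.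
    by apply: contrapT => ki; apply: nk; exists k; split=> //; exists i.
  have [ki0|ki0] := ltrP 0 (k i); first by exists k; split=> //; exists i.
  exists (fun i => - k i); split; last first.
    by exists i; rewrite oppr_gt0 lt_neqAle ki.
  by under eq_bigr do rewrite scaleNr; rewrite sumrN kX oppr0.
exists (fun j => \sum_i k i * (enum_val i == j)%:R); split.
- exists (enum_val i0); first exact: enum_valP.
  rewrite (bigD1 i0)//= eqxx mulr1 big1 ?addr0// => i ii0.
  by rewrite (inj_eq enum_val_inj) (negbTE ii0) mulr0.
- move=> j jA; rewrite big1// => i _; case: eqP => [ij|]; last by rewrite mulr0.
  by move: jA; rewrite -ij enum_valP.
- under eq_bigr do rewrite scaler_suml.
  rewrite exchange_big -[RHS]kX; apply: eq_bigr => i _ /=.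
  rewrite (bigD1 (enum_val i))//= eqxx mulr1 big1 ?addr0.
    by rewrite (nth_map i) ?size_enum_ord ?nth_ord_enum.
  by move=> j; rewrite eq_sym => /negbTE ->; rewrite mulr0 scale0r.
Qed.

(** Induction on the number of nonzero weights: while it exceeds the dimension, a multiple of a
    linear dependence is subtracted so that one more weight vanishes. *)
Lemma conic_caratheodory (a : 'I_m -> R) : (forall i, 0 <= a i) ->
  exists b : 'I_m -> R, [/\ forall i, 0 <= b i,
    \sum_i b i *: v i = \sum_i a i *: v i &
    (#|[pred i | b i != 0%R]| <= \dim {:U})%N].
Proof.
have [n] := ubnP #|[pred i | a i != 0%R]|; elim: n a => // n IHn a an a0.
set A : {pred 'I_m} := [pred i | a i != 0] in an.
have [Ad|dA] := leqP #|A| (\dim {:U}); first by exists a.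
have [mu [[i1 i1A mui1] muA muv]] := linear_dependence dA.
(* The minimal ratio is the largest multiple of [mu] that can be subtracted with all weights staying
   nonnegative; the weight at [i0] becomes 0. *)
have [i0 mui0 min_i0] := @Order.TotalTheory.arg_minP _ R _ i1
  (fun i => 0 < mu i) (fun i => a i / mu i) mui1.
pose t := a i0 / mu i0.
have t0 : 0 <= t by rewrite divr_ge0// ltW.
have i0A : i0 \in A.
  by apply: contraT => /muA mui00; rewrite mui00 ltxx in mui0.
pose a' i := a i - t * mu i.
have a'0 i : 0 <= a' i.
  rewrite subr_ge0; have [mui|mui] := ltrP 0 (mu i).
    by rewrite -ler_pdivlMr// min_i0.
  by rewrite (le_trans _ (a0 i))// mulr_ge0_le0.
have [|b [b0 bv bU]] := IHn a' _ a'0.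
  rewrite -ltnS (leq_trans _ an)// ltnS; apply: proper_card; apply/properP; split.
    apply/fintype.subsetP => i; rewrite !inE; apply: contra => /eqP ai0.
    by rewrite /a' ai0 (muA i) ?mulr0 ?subrr// !inE ai0 eqxx.
  exists i0 => //; rewrite inE negbK /a' /t divfK ?subrr//.
  by rewrite gt_eqF.
exists b; split=> //; rewrite bv /a'.
under eq_bigr do rewrite scalerBl -scalerA.
by rewrite sumrB -scaler_sumr muv scaler0 subr0.
Qed.

End Caratheodory.

(** * Closedness of the convex hull of a compact set *)

Section CompactHull.
Variables (R : realType).

(* Conic combinations of at most [n] vectors of [B] with weights at most 1: a
   compact set when [B] is compact. For [B = {1} x S] its slice at height 1
   is made of the convex combinations of at most [n] points of [S]. *)
Fixpoint bounded_cone (E : normedModType R) (B : set E) n : set E :=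
  if n is n'.+1 then
    [set p.1 + p.2.1 *: p.2.2 |
      p in bounded_cone B n' `*` (`[0, 1]%classic `*` B)]
  else [set 0].

Lemma compact_bounded_cone (E : normedModType R) (B : set E) n :
  compact B -> compact (bounded_cone B n).
Proof.
move=> cB; elim: n => [|n IHn] /=; first exact: compact_set1.
apply: continuous_compact; last first.
  by apply: compact_setX => //; apply: compact_setX => //; exact: segment_compact.
apply: continuous_subspaceT => p; apply: cvgD; first exact: cvg_fst.
apply: cvgZ.
  by apply: (@continuous_comp _ _ _ snd fst); [exact: cvg_snd|exact: cvg_fst].
by apply: (@continuous_comp _ _ _ snd snd); exact: cvg_snd.
Qed.

Lemma bounded_cone_sum (E : normedModType R) (B : set E) (I : eqType)
    (s : seq I) (a : I -> R) (v : I -> E) :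
  (forall i, i \in s -> 0 <= a i <= 1) -> (forall i, i \in s -> B (v i)) ->
  bounded_cone B (size s) (\sum_(i <- s) a i *: v i).
Proof.
elim: s => [|i s IHs] a01 Bv /=; first by rewrite big_nil.
exists (\sum_(j <- s) a j *: v j, (a i, v i)); last by rewrite big_cons addrC.
split=> /=; first by apply: IHs => j js; [apply: a01|apply: Bv]; rewrite inE js orbT.
split=> /=; last by apply: Bv; rewrite mem_head.
by rewrite in_itv/= a01 ?mem_head.
Qed.

Lemma bounded_cone_le (E : normedModType R) (B : set E) m n : B !=set0 ->
  (m <= n)%N -> bounded_cone B m `<=` bounded_cone B n.
Proof.
move=> [b Bb]; elim: n m => [|n IHn] m; first by rewrite leqn0 => /eqP ->.
rewrite leq_eqVlt => /orP[/eqP -> //|/IHn mn x /mn xn].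
exists (x, (0, b)); last by rewrite scale0r addr0.
by split=> //; split=> //=; rewrite in_itv/= lexx ler01.
Qed.

Variable V : innerSpaceType R.
Implicit Types (S : set V) (x : V).

Definition combination S : set V := [set x | exists s : seq (R * V),
  [/\ forall p, p \in s -> 0 <= p.1 /\ S p.2,
      \sum_(p <- s) p.1 = 1 & x = \sum_(p <- s) p.1 *: p.2]].

Lemma convex_hull_combination S : convex_hull S `<=` combination S.
Proof.
apply: smallest_sub; last first.
  move=> x Sx; exists [:: (1, x)]; split; last by rewrite big_seq1 scale1r.
    by move=> p; rewrite inE => /eqP ->.
  by rewrite big_seq1.
apply/convex_setP => x y t [s1 [s1P s1E xE]] [s2 [s2P s2E yE]] t0 t1.
exists ([seq (t * p.1, p.2) | p <- s1] ++ [seq ((1 - t) * p.1, p.2) | p <- s2]).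
split.
- move=> p; rewrite mem_cat => /orP[] /mapP[q qs ->] /=.
    by have [q0 Sq] := s1P _ qs; rewrite mulr_ge0.
  by have [q0 Sq] := s2P _ qs; rewrite mulr_ge0// subr_ge0.
- by rewrite big_cat !big_map/= -!mulr_sumr s1E s2E !mulr1 subrKC.
- rewrite big_cat !big_map/= xE yE !scaler_sumr.
  by congr (_ + _); apply: eq_bigr => p _; rewrite scalerA.
Qed.

(** The first coordinate accumulates the total weight, so dividing by it yields a point of the
    hull. *)
Lemma bounded_cone_hull S n r y :
  bounded_cone ([set (1 : R)] `*` S : set (R * V)%type) n (r, y) ->
  S !=set0 -> 0 <= r /\ exists2 h, convex_hull S h & y = r *: h.
Proof.
move=> ry [s0 Ss0]; elim: n r y ry => [|n IHn] r y /=.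
  move=> [-> ->]; split=> //; exists s0; last by rewrite scale0r.
  exact: sub_gen_smallest.
move=> [[[r' y'] [t [u s]]] /= [/IHn[r'0 [h hS ->]]]] [].
rewrite in_itv/= => /andP[t0 t1] [-> Ss] [<- <-] /=.
have hs : convex_hull S s by exact: sub_gen_smallest.
rewrite [t *: 1]mulr1; split; first exact: addr_ge0.
(* With total weight 0 there is nothing to normalize: the vector part is 0 and any point of the hull
   serves. *)
have [rt0|rt_neq0] := eqVneq (r' + t) 0.
  have r'E : r' = 0 by lra.
  have tE : t = 0 by lra.
  by exists s => //; rewrite r'E tE addr0 !scale0r addr0.
have rt_gt0 : 0 < r' + t by rewrite lt_neqAle eq_sym rt_neq0 addr_ge0.
exists (r' / (r' + t) *: h + (1 - r' / (r' + t)) *: s).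
  have /convex_setP := @convex_convex_hull _ _ S; apply => //.
    exact: divr_ge0 (ltW _).
  by rewrite ler_pdivrMr// mul1r lerDl.
rewrite scalerDr !scalerA; congr (_ *: _ + _ *: _); field => //.
Qed.

(** Lifting [S] to height 1 in [R * V] turns convex combinations into conic ones, so Caratheodory
    bounds the number of terms by the dimension of the product. The hull is then a slice of a
    compact set. *)
Lemma closed_convex_hull_compact S : S !=set0 -> compact S ->
  closed (convex_hull S).
Proof.
move=> S0 cS; pose B : set (R * V)%type := [set 1] `*` S.
pose n := \dim {: (R^o * V)%type}.
suff -> : convex_hull S = (fun x : V => (1 : R, x)) @^-1` bounded_cone B n.
  apply: preimage_closed.
    move=> x _; apply: (@cvg_pair _ _ _ _ (nbhs (1 : R)) (nbhs x)).
      exact: cvg_cst.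
    exact: cvg_id.
  apply: compact_closed; first exact: (@norm_hausdorff R (R * V)%type).
  by apply: compact_bounded_cone; apply: compact_setX => //; exact: compact_set1.
apply/seteqP; split=> x; last first.
  by move=> /bounded_cone_hull => /(_ S0)[_ [h hS ->]]; rewrite scale1r.
move=> /convex_hull_combination[s [sP s1 xE]].
pose q := tnth (in_tuple s).
pose v (i : 'I_(size s)) : (R^o * V)%type := (1, (q i).2).
have q0 i : 0 <= (q i).1 by have [] := sP _ (mem_tnth i (in_tuple s)).
have qS i : S (q i).2 by have [] := sP _ (mem_tnth i (in_tuple s)).
have [b [b0 bv bn]] := conic_caratheodory v q0.
have sum1 (a : 'I_(size s) -> R) : (\sum_i a i *: v i).1 = \sum_i a i.
  rewrite (raddf_sum fst); apply: eq_bigr => i _; exact: mulr1.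
have bE : \sum_i b i = 1 by rewrite -(sum1 b) bv sum1 -[RHS]s1 [RHS]big_tnth.
have bx : \sum_i b i *: v i = (1, x).
  rewrite [LHS]surjective_pairing sum1 bE bv; congr pair.
  by rewrite (raddf_sum snd) xE [RHS]big_tnth; apply: eq_bigr.
rewrite /= -bx (bigID (fun i => b i != 0))/= [X in _ + X]big1 ?addr0; last first.
  by move=> i /negPn/eqP ->; rewrite scale0r.
rewrite -big_enum; apply: (bounded_cone_le _ bn).
  by case: S0 => s0 Ss0; exists (1, s0).
rewrite cardE; apply: (@bounded_cone_sum (R * V)%type) => i _; last first.
  by split; [|exact: qS].
by rewrite b0/= -bE (bigD1 i)//= lerDl sumr_ge0.
Qed.

End CompactHull.

(** * The map of an FTvN system and its fibres *)

Section FTvN.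
Variables (R : realType) (V W : innerSpaceType R) (lam : V -> W).
Hypothesis lamP : is_FTvN lam.
Implicit Types (x y c : V) (u w : W) (D E : set W).
Local Notation K := (range lam).

Lemma inner_lam_le x y : '<<x, y>> <= '<<lam x, lam y>>.
Proof. exact: lamP.1. Qed.

Lemma lam_attain c x : exists2 y, lam y = lam x & '<<c, y>> = '<<lam c, lam x>>.
Proof.
have [|y [ly cy]] := lamP.2 c (lam x); first by exists x.
by exists y => //; rewrite cy ly.
Qed.

(** (P2) with c = x gives [y] in the fibre of [x] with <x, y> = |lam x|^2. By (P1) neither |x|^2 nor
    |y|^2 exceeds this value, so x = y. *)
Lemma inner_lam x : '<<lam x, lam x>> = '<<x, x>>.
Proof.
have [y lyx xy] := lam_attain x x; have := inner_lam_le y y.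
rewrite lyx -xy => yy.
by have <- : x = y by apply: inner_eq => //; rewrite xy inner_lam_le.
Qed.

(** Equality in (P1) gives both sides the same norm, and (P1) for [z] against [x] and [y] makes
    their inner product at least the squared norm. *)
Lemma lam_comb x y s t : 0 <= s -> 0 <= t ->
  '<<x, y>> = '<<lam x, lam y>> ->
  lam (s *: x + t *: y) = s *: lam x + t *: lam y.
Proof.
move=> s0 t0 xy;
  move: {-2}(s *: x + t *: y) (erefl (s *: x + t *: y)) => z zdef.
have zE : '<<z, z>> = s * '<<z, x>> + t * '<<z, y>> 
  by rewrite -!innerZr -innerDr -zdef.
have lE : '<<s *: lam x + t *: lam y, s *: lam x + t *: lam y>> = '<<z, z>>.
  rewrite zdef !innerE !inner_lam [inner (lam y) _]innerC -xy.
  by rewrite [inner y x]innerC.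
have zl : '<<z, z>> <= '<<lam z, s *: lam x + t *: lam y>>.
  rewrite innerDr !innerZr zE.
  by apply: lerD; apply: ler_wpM2l => //; exact: inner_lam_le.
by apply: inner_eq; rewrite ?inner_lam ?lE.
Qed.

(** [lam] preserves norms and, by (P1), never decreases inner products. *)
Lemma lam_lip x y : `|lam x - lam y| <= `|x - y|.
Proof.
apply: norm_le_inner; rewrite !innerE !inner_lam.
by rewrite [inner (lam y) _]innerC [inner y x]innerC; have := inner_lam_le x y; lra.
Qed.

Lemma lam_continuous : continuous lam.
Proof.
move=> x; apply/cvgrPdist_lt => e e0; near=> y.
rewrite (le_lt_trans (lam_lip _ _))//.
Unshelve. all: by end_near. Qed.

(** (P2) replaces the preimage of the second point by one with equality in (P1) against [x], so that
    [lam_comb] applies. *)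
Lemma convex_range_lam : convex_set K.
Proof.
apply/convex_setP => _ _ t [x _ <-] [y0 _ <-] t0 t1.
have [y <- xy] := lam_attain x y0.
by exists (t *: x + (1 - t) *: y) => //; rewrite lam_comb ?subr_ge0// xy.
Qed.

(* By (P2) every element of [K] is some [lam w] whose pairing with [lam z],
   for the given [z], equals that of [w] with [z]. *)
Lemma lam_sublinear x y s t : 0 <= s -> 0 <= t ->
  polar K (lam (s *: x + t *: y) - (s *: lam x + t *: lam y)).
Proof.
move=> s0 t0 _ [w0 _ <-].
have [w <- zw] := lam_attain (s *: x + t *: y) w0.
rewrite innerDl innerNl subr_le0.
have -> : '<<lam (s *: x + t *: y), lam w>> = '<<s *: x + t *: y, w>>.
  by rewrite zw.
rewrite !innerDl !innerZl.
by apply: lerD; apply: ler_wpM2l => //; exact: inner_lam_le.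
Qed.

Lemma convex_preimage_lam D : convex_set D ->
  convex_set (lam @^-1` minkowski_sum D (polar K)).
Proof.
move=> cD; have := convex_minkowski_sum cD (@convex_polar _ _ K).
move=> /convex_setP cDK; apply/convex_setP => x y t Dx Dy t0 t1 /=.
have [d Dd [k Kk dkE]] := cDK _ _ t Dx Dy t0 t1.
have Kl := lam_sublinear x y t0 (etrans (subr_ge0 _ _) t1).
exists d => //; exists (k + (lam (t *: x + (1 - t) *: y) -
    (t *: lam x + (1 - t) *: lam y))).
  by move=> w Kw; rewrite innerDl -[leRHS]addr0 lerD ?Kk ?Kl.
by rewrite addrA dkE addrC subrK.
Qed.

Lemma sub_preimage_lam D : convex_set D ->
  convex_hull (lam @^-1` D) `<=` lam @^-1` minkowski_sum D (polar K).
Proof.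
move=> cD; apply: smallest_sub; first exact: convex_preimage_lam.
by move=> x Dx; exact: sub_minkowski_sum_polar.
Qed.

Lemma convex_hull_fiber u x : K u ->
  (forall w, K w -> '<<lam x, w>> <= '<<u, w>>) ->
  convex_hull (lam @^-1` [set u]) x.
Proof.
move=> [x0 _ x0u] xu; set S := lam @^-1` [set u].
have S0 : S !=set0 by exists x0.
(* [lam] preserves norms, so the fibre lies on the sphere of radius |x0|. *)
have cS : compact S.
  apply: (@bounded_closed_compact_inner _ _ _ `|x0|).
    by move=> y Sy; apply: norm_le_inner; rewrite -!inner_lam x0u Sy.
  apply: (continuous_closedP _).1 lam_continuous _ _.
  exact: (compact_closed (@norm_hausdorff _ W) (@compact_set1 _ u)).
rewrite [convex_hull S](closure_id _).1; last exact: closed_convex_hull_compact.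
apply: support_closed_convex_hull => // c e e0.
have [y yx0 cy] := lam_attain c x0; exists y; first by rewrite /S/= yx0.
rewrite cy x0u; apply: le_trans (inner_lam_le _ _) _.
have := xu (lam c) (ex_intro2 _ _ c I erefl).
by rewrite ![inner _ (lam c)]innerC; lra.
Qed.

(* If [lam y = t a + (1 - t) b], then (P2) at [y] yields [a'] and [b'] above
   [a] and [b] with [y = t a' + (1 - t) b']. *)
Lemma preimage_lam_convex_hull E : E `<=` K ->
  lam @^-1` convex_hull E `<=` convex_hull (lam @^-1` E).
Proof.
move=> EK x Ex; set X := convex_hull _.
(* The property concerns whole fibres because (P2) changes preimages within a fibre; the clause on
   [K] supplies the points to which (P2) is applied. *)
suff : K (lam x) /\ lam @^-1` [set lam x] `<=` X by case=> _; exact.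
pose T := [set u | K u /\ lam @^-1` [set u] `<=` X].
apply: (@smallest_sub _ _ E T) Ex; last first.
  move=> u Eu; split; first exact: EK.
  by move=> y yu; apply: sub_gen_smallest; rewrite /= yu.
apply/convex_setP => _ _ t [[a _ <-] aX] [[b _ <-] bX] t0 t1; split.
  by have /convex_setP := convex_range_lam; apply => //.
move=> y /= ly; have [a' la' ya] := lam_attain y a;
have [b' lb' yb] := lam_attain y b.
suff -> : y = t *: a' + (1 - t) *: b'.
  have /convex_setP := @convex_convex_hull _ _ (lam @^-1` E).
  by apply => //; [exact: aX|exact: bX].
have yE : '<<y, t *: a' + (1 - t) *: b'>> = '<<lam y, lam y>>.
  by rewrite innerDr !innerZr ya yb -!innerZr -innerDr -ly.
(* (P1) for [a'] and [b'] bounds the squared norm of the combination by |lam y|^2, which is also its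
   inner product with [y]. *)
apply: inner_eq; rewrite yE; first by rewrite inner_lam.
rewrite ly !innerE -la' -lb' !inner_lam.
rewrite [inner b' a']innerC [inner (lam b') _]innerC.
have t1' : 0 <= t * (1 - t) by rewrite mulr_ge0 ?subr_ge0.
by have := ler_wpM2l t1' (inner_lam_le a' b'); lra.
Qed.

Lemma minkowski_sum_polarP D u : minkowski_sum D (polar K) u ->
  exists2 d, D d & forall w, K w -> '<<u, w>> <= '<<d, w>>.
Proof.
move=> [d Dd [k Kk <-]]; exists d => // w Kw.
by rewrite innerDl gerDl Kk.
Qed.

(** * Preimages of feasible sets and the two equivalences *)

Section Feasible.
Variable C : set W.
Local Notation A := (C `&` K).

Lemma preimage_lamI : lam @^-1` C = lam @^-1` A.
Proof. by apply/seteqP; split=> [x Cx|x []//]; split=> //; exists x. Qed.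

Lemma convex_hull_sub_range : convex_hull A `<=` K.
Proof. by apply: smallest_sub; [exact: convex_range_lam|move=> ? []]. Qed.

Lemma convex_hull_preimage_lam : convex_hull (lam @^-1` C) =
  lam @^-1` minkowski_sum (convex_hull A) (polar K).
Proof.
rewrite preimage_lamI; apply/seteqP; split.
  apply: subset_trans (sub_preimage_lam (@convex_convex_hull _ _ A)).
  apply: sub_smallest2r; first exact: convex_convex_hull.
  by move=> x Ax; exact: sub_gen_smallest.
(* The point [d] dominating [lam x] puts [x] in the hull of its fibre, and that fibre lies in the
   hull of the preimage of [A]. *)
move=> x /minkowski_sum_polarP[d Ad xd].
have Kd := convex_hull_sub_range Ad.
have := convex_hull_fiber Kd xd.
apply: smallest_sub; first exact: convex_convex_hull.
move=> y yd; apply: preimage_lam_convex_hull; first by move=> ? [].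
by rewrite /= yd.
Qed.

Lemma convex_hull_inner_le c M :
  (forall a, A a -> '<<lam c, a>> <= M) ->
  forall d, convex_hull A d -> '<<lam c, d>> <= M.
Proof.
move=> AM d Ad.
apply: (@smallest_sub _ _ A [set d | '<<lam c, d>> <= M]) Ad => //.
apply/convex_setP => x y t /= xM yM t0 t1; rewrite !innerE; nra.
Qed.

Hypothesis feasC : A !=set0.

Lemma preimage_lam_closure :
  lam @^-1` closure (minkowski_sum (convex_hull A) (polar K)) `<=`
  closed_convex_hull (lam @^-1` C).
Proof.
move=> x /closure_normP xcl; rewrite preimage_lamI.
apply: support_closed_convex_hull.
  by case: feasC => u [Cu [y _ yu]]; exists y; split; rewrite ?yu//; exists y.
move=> c e e0; apply: contrapT => /forall2NP nsupp.
(* This radius gives |lam c| r < e; adding 1 covers the case [lam c = 0]. *)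
pose r := e / (`|lam c| + 1).
have c1 : 0 < `|lam c| + 1 by rewrite ltr_wpDl.
have [u /minkowski_sum_polarP[d Ad ud] xu] := xcl r (divr_gt0 e0 c1).
have Kc : K (lam c) by exists c.
(* (P2) realizes <lam c, a> as <c, y> with [y] over [a], so the failed support in direction [c]
   bounds all of [A]. *)
have : '<<lam c, d>> <= '<<c, x>> - e.
  apply: convex_hull_inner_le Ad => a [Ca [a0 _ a0a]].
  have [y ly cy] := lam_attain c a0; have [] := nsupp y.
    by case; rewrite /= ly a0a; split=> //; exists a0.
  by move=> /negP; rewrite -ltNge cy a0a; lra.
have := ud _ Kc; rewrite ![inner _ (lam c)]innerC.
have := inner_lam_le c x; have := inner_le_norm (lam c) (lam x - u).
rewrite innerDr innerNr.
have : `|lam c| * `|lam x - u| < e.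
  rewrite (le_lt_trans (ler_wpM2l _ (ltW xu)))// /r mulrCA gtr_pMr//.
  by rewrite ltr_pdivrMr// mul1r ltrDl.
lra.
Qed.

Lemma closed_convex_hull_preimage_lam : closed_convex_hull (lam @^-1` C) =
  closure (lam @^-1` minkowski_sum (convex_hull A) (polar K)).
Proof. by rewrite /closed_convex_hull convex_hull_preimage_lam. Qed.

Lemma lam_closure D :
  closure (lam @^-1` D) `<=` lam @^-1` closure D.
Proof.
move=> x /closure_normP xD; apply/closure_normP => e /xD[y Dy xy].
by exists (lam y) => //; rewrite (le_lt_trans (lam_lip _ _)).
Qed.

Lemma convex_hull_feasible_sub : convex_hull A `<=` convex_hull C `&` K.
Proof.
move=> u Au; split; last exact: convex_hull_sub_range.
by apply: sub_smallest2r Au; [exact: convex_convex_hull|move=> ? []].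
Qed.

(** For (a) to (b), [D] lies between two sets whose sums with K° agree, as K° + K° = K°. (b) to (c)
    takes the largest [D], and (c) to (a) tests the equality at a preimage of [u]. *)
Lemma convex_hull_preimage_tfae :
  [<-> convex_hull C `&` K `<=` minkowski_sum (convex_hull A) (polar K);
       forall D : set W, convex_set D ->
         convex_hull A `<=` D -> D `<=` convex_hull C `&` K ->
         convex_hull (lam @^-1` C) = lam @^-1` (minkowski_sum D (polar K));
       convex_hull (lam @^-1` C) =
         lam @^-1` (minkowski_sum (convex_hull C `&` K) (polar K))].
Proof.
tfae.
- move=> CA D _ AD DC; rewrite convex_hull_preimage_lam.
  apply/seteqP; split=> x /=; first exact: minkowski_sumS.
  move=> [d /DC/CA[a Aa [k Kk <-]] [l Kl <-]]; exists a => //.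
  exists (k + l); last by rewrite addrA.
  by move=> w Kw; rewrite innerDl -[leRHS]addr0 lerD ?Kk ?Kl.
- move=> allD; apply: allD => //; last exact: convex_hull_feasible_sub.
  by apply: convex_setI; [exact: convex_convex_hull|exact: convex_range_lam].
- rewrite convex_hull_preimage_lam => CE u [Cu [x _ xu]].
  move: Cu; rewrite -xu => Cx.
  have : (lam @^-1` minkowski_sum (convex_hull A) (polar K)) x; last by [].
  by rewrite CE; apply: sub_minkowski_sum_polar; split=> //; exists x.
Qed.

Lemma closed_convex_hull_preimage_tfae :
  [<-> closed_convex_hull C `&` K `<=`
         closure (minkowski_sum (closed_convex_hull A) (polar K));
       forall D : set W, convex_set D ->
         convex_hull A `<=` D -> D `<=` closed_convex_hull C `&` K ->
         closed_convex_hull (lam @^-1` C) =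
           closure (lam @^-1` (minkowski_sum D (polar K)));
       closed_convex_hull (lam @^-1` C) =
         closure (lam @^-1` (minkowski_sum (closed_convex_hull C `&` K)
                                           (polar K)))].
Proof.
tfae.
- move=> CA D _ AD DC; apply/seteqP; split.
    rewrite closed_convex_hull_preimage_lam; apply: closureS => x /=.
    exact: minkowski_sumS.
  rewrite [X in _ `<=` X](closure_id _).1; last exact: closed_closure.
  (* By [preimage_lam_closure] it is enough that [D] + K° lies in the closure of conv [A] + K°. *)
  apply: closureS => x [d /DC/CA Ad [k Kk dk]]; apply: preimage_lam_closure => /=.
  rewrite -dk; apply: closure_minkowski_sum_polar => //.
  (* The outer closure allows the closed hull of [A] to be replaced by the hull itself. *)
  have /closure_id -> :=
    @closed_closure _ (minkowski_sum (convex_hull A) (polar K)).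
  apply: closureS Ad => _ [a Aa [l Kl <-]].
  apply: closure_minkowski_sum_polar => //.
  by apply: closureS Aa; exact: sub_minkowski_sum_polar.
- move=> allD; apply: allD => //.
    apply: convex_setI; last exact: convex_range_lam.
    by apply: convex_closure; exact: convex_convex_hull.
  move=> u /convex_hull_feasible_sub[Cu Ku]; split=> //; exact: subset_closure.
- rewrite closed_convex_hull_preimage_lam => CE u [Cu [x _ xu]].
  move: Cu; rewrite -xu => Cx.
  apply: (@closureS _ (minkowski_sum (convex_hull A) (polar K))).
    by apply: minkowski_sumS; exact: subset_closure.
  suff : closure (lam @^-1` minkowski_sum (convex_hull A) (polar K)) x.
    exact: lam_closure.
  rewrite CE; apply: subset_closure.
  by apply: sub_minkowski_sum_polar; split=> //; exists x.
Qed.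

End Feasible.
End FTvN.

Theorem theorem3p3 (R : realType) (V W : innerSpaceType R) (lam : V -> W)
    (lamP : is_FTvN lam) (C : set W) (feasC : C `&` range lam !=set0) :
  let K := range lam in
  [<-> convex_hull C `&` K `<=`
         minkowski_sum (convex_hull (C `&` K)) (polar K);
       forall D : set W, convex_set D ->
         convex_hull (C `&` K) `<=` D -> D `<=` convex_hull C `&` K ->
         convex_hull (lam @^-1` C) = lam @^-1` (minkowski_sum D (polar K));
       convex_hull (lam @^-1` C) =
         lam @^-1` (minkowski_sum (convex_hull C `&` K) (polar K))]
  /\
  [<-> closed_convex_hull C `&` K `<=`
         closure (minkowski_sum (closed_convex_hull (C `&` K)) (polar K));
       forall D : set W, convex_set D ->
         convex_hull (C `&` K) `<=` D -> D `<=` closed_convex_hull C `&` K ->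
         closed_convex_hull (lam @^-1` C) =
           closure (lam @^-1` (minkowski_sum D (polar K)));
       closed_convex_hull (lam @^-1` C) =
         closure (lam @^-1` (minkowski_sum (closed_convex_hull C `&` K)
                                           (polar K)))].
Proof.
split; first exact: (convex_hull_preimage_tfae lamP C).
exact: (closed_convex_hull_preimage_tfae lamP feasC).
Qed.
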